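(* Let $n$ be a positive integer, let $p$ be the peak value of the Collatz sequence starting at $n$, and let $u$ be the odd number immediately before $p$. Let $v$ be the odd number immediately after $p$. Then $v<u$.
   Context: The Collatz map $T$ on the positive integers is $T(m)=m/2$ if $m$ is even and $T(m)=3m+1$ if $m$ is odd; $T^k$ denotes its $k$-fold iterate. The Collatz sequence starting at $n$ is $n, T(n), T^2(n),\dots$. Its peak value $p$ is the maximum value within this sequence. The odd number $u$ immediately before $p$ is the odd term of the sequence directly preceding $p$, so that $p=T(u)=3u+1$. The odd number $v$ immediately after $p$ is the first odd term following $p$ in the sequence, i.e. the odd number obtained from $p$ by dividing out the largest power of $2$ that divides $p$.
   Formalization: The starting values n = 1, 2, 4 are excluded: their Collatz sequences run through the cycle 1, 4, 2, so p = 4 and u = v = 1, and v < u fails. *)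

(* Defs.v *)
From mathcomp Require Import all_boot.

Set Implicit Arguments.
Unset Strict Implicit.
Unset Printing Implicit Defensive.

Definition collatz (m : nat) : nat := if odd m then 3 * m + 1 else m./2.

(* The sequence is infinite: it is not stopped at 1, so the sequences starting
   at 1, 2 and 4 run through the cycle 1, 4, 2, with peak 4, and 1 is the odd
   term both before and after this peak. *)
Definition collatz_seq (n k : nat) : nat := iter k collatz n.

(* An unbounded sequence has no peak. *)
Definition collatz_peak (n p : nat) : Prop :=
  (exists k, collatz_seq n k = p) /\ (forall k, collatz_seq n k <= p).

Definition odd_before (n p u : nat) : Prop :=
  exists k, [/\ odd u, collatz_seq n k = u & collatz_seq n k.+1 = p].

Definition odd_after (n p v : nat) : Prop :=
  exists k j, [/\ collatz_seq n k = p, 0 < j, odd v, collatz_seq n (k + j) = v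
    & forall i, 0 < i < j -> ~~ odd (collatz_seq n (k + i))].

(* Main.v *)
Require Import Defs.
From mathcomp Require Import all_boot zify.

(** The peak [p = 3u + 1] is even because [u] is odd. It is even a multiple of
    [4]: otherwise [p / 2] would be an odd term of the sequence, and its
    successor [3 (p / 2) + 1] would exceed the peak ([half_peak_even]). So at
    least two halvings separate [p] from [v], and since all the terms between
    them are halved ([collatz_seq_even_run]), [v <= p / 4 = (3u + 1) / 4 <= u].
    Equality forces [u = 1], that is [p = 4]; a positive starting value bounded
    by [4] is [1], [2], [4], all excluded, or [3], which is followed by
    [10 > 4]. *)

Lemma collatz_seqS n k : collatz_seq n k.+1 = collatz (collatz_seq n k).
Proof. by rewrite /collatz_seq iterS. Qed.

Lemma collatz_odd m : odd m -> collatz m = 3 * m + 1.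
Proof. by rewrite /collatz => ->. Qed.

Lemma collatz_even m : ~~ odd m -> collatz m = m./2.
Proof. by rewrite /collatz => /negbTE->. Qed.

Lemma collatz_seq_even_run n m j :
  (forall i, i < j -> ~~ odd (collatz_seq n (m + i))) ->
  collatz_seq n (m + j) <= collatz_seq n m.
Proof.
elim: j => [|j IHj] evens; first by rewrite addn0.
rewrite addnS collatz_seqS collatz_even ?evens //.
have le_j : collatz_seq n (m + j) <= collatz_seq n m.
  by apply: IHj => i lt_ij; apply/evens/ltnW.
lia.
Qed.

(** An odd term [q] has successor [3q + 1 > 2q], so twice an odd term is never
    an upper bound of the sequence. *)
Lemma half_peak_even n p :
  collatz_peak n p -> ~~ odd p -> ~~ odd p./2.
Proof.
case=> [[k seq_k] bound] p_even; apply/negP => half_odd.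
have := bound k.+2.
rewrite !collatz_seqS seq_k (collatz_even p) // collatz_odd //.
lia.
Qed.

Lemma collatz_peak_neq4 n : 0 < n -> n \notin [:: 1; 2; 4] ->
  ~ collatz_peak n 4.
Proof.
move=> n_gt0 n_notin [_ bound].
have := bound 0; have := bound 1.
by case: n n_gt0 n_notin {bound} => [|[|[|[|[|n]]]]].
Qed.

Theorem theorem2p12 (n p u v : nat) (hn : 0 < n)
    (hn124 : n \notin [:: 1; 2; 4])
    (hp : collatz_peak n p) (hu : odd_before n p u) (hv : odd_after n p v) :
  v < u.
Proof.
have [k [u_odd seq_u]] := hu.
rewrite collatz_seqS seq_u collatz_odd // => def_p.
have p_even : ~~ odd p by lia.
have half_even := half_peak_even _ _ hp p_even.
have u_neq1 : u <> 1.
  move=> u1; apply: (collatz_peak_neq4 n) => //.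
  by move: hp; rewrite -def_p u1.
have [l [j [seq_p j_gt0 v_odd seq_v evens]]] := hv.
have seq_half : collatz_seq n l.+1 = p./2.
  by rewrite collatz_seqS seq_p collatz_even.
have seq_quarter : collatz_seq n l.+2 = p./2./2.
  by rewrite collatz_seqS seq_half collatz_even.
case: j j_gt0 seq_v evens => [|[|j]] // _ seq_v evens.
  by move: half_even; rewrite -seq_half -addn1 seq_v v_odd.
have v_le : v <= p./2./2.
  rewrite -seq_v -seq_quarter -!addSnnS; apply: collatz_seq_even_run => i lt_ij.
  by rewrite !addSnnS; apply: evens; rewrite !ltnS.
lia.
Qed.
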